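(* Let $R$ be a ranking profile over $m$ candidates and $\rhd$ the ranking chosen by the Flow-adjusting Borda rule for $R$. Then for every subprofile $S$ of $R$ with $|S|>0$, $$\frac{1}{|S|}\sum_{\succ\in\mathcal{R}}S(\succ)u(\succ,\rhd)\geq\binom{m}{2}\frac{|S|}{4}-\frac{3}{16}.$$
   Context: Let $C$ be a set of $m$ candidates. A ranking is a strict linear order over $C$; $\mathcal{R}$ denotes the set of all rankings over $C$. A ranking profile is a function $R:\mathcal{R}\to[0,1]$ with $\sum_\succ R(\succ)=1$; a subprofile of $R$ is $S:\mathcal{R}\to[0,1]$ with $S(\succ)\leq R(\succ)$ for all $\succ$, and $|S|=\sum_\succ S(\succ)$. For rankings $\succ,\rhd$, $u(\succ,\rhd)=|\{(x,y)\in C^2:x\succ y\text{ and }x\rhd y\}|$; for $x\in X\subseteq C$, $u(\succ,x,X)=|\{y\in X\setminus\{x\}:x\succ y\}|$; for $b:\mathcal{R}\to\mathbb{R}_{\geq0}$, $U(b,x,X)=\sum_\succ b(\succ)u(\succ,x,X)$. Flow-adjusting Borda rule: set $X_1=C$, $b_1(\succ)=R(\succ)\binom{m}{2}$. In round $i=1,\dots,m$: choose $x^*\in\arg\max_{x\in X_i}U(b_i,x,X_i)$ (ties arbitrary), place it at position $i$, set $X_{i+1}=X_i\setminus\{x^*\}$. Build the flow network $G_{x^*}$ with source $s$, a vertex $v_\succ$ for each $\succ\in\mathcal{R}$, a vertex $v_y$ for each $y\in X_i\setminus\{x^*\}$, and sink $t$; edges $(s,v_\succ)$ of capacity $b_i(\succ)$,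 edges $(v_\succ,v_y)$ of unbounded capacity whenever $x^*\succ y$, and edges $(v_y,t)$ of capacity $1$. Choose a maximum $s$-$t$ flow $f$ in $G_{x^*}$ that, among all maximum flows, minimizes $\max_{\succ\in\mathcal{R}}\frac{f(s,v_\succ)}{b_i(\succ)\,u(\succ,x^*,X_i)}$ (convention $0/0=0$), and set $b_{i+1}(\succ)=b_i(\succ)-f(s,v_\succ)$. *)

(* Defs.v *)
From HB Require Import structures.
From mathcomp Require Import all_boot all_order all_algebra all_fingroup.
From mathcomp Require Import reals.
Set Implicit Arguments. Unset Strict Implicit. Unset Printing Implicit Defensive.
Import Order.TTheory GRing.Theory Num.Theory.
Local Open Scope ring_scope.

(* Candidates are 'I_m.  A ranking (strict linear order on candidates) is
   represented by a permutation s : {perm 'I_m}, where s x is the position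
   of candidate x (0 = top).  x is preferred to y iff s x < s y. *)
Definition prefers m (s : {perm 'I_m}) (x y : 'I_m) : bool := (s x < s y)%N.

Definition u_agree m (s t : {perm 'I_m}) : nat :=
  #|[set p : 'I_m * 'I_m | prefers s p.1 p.2 && prefers t p.1 p.2]|.

Definition u_in m (s : {perm 'I_m}) (x : 'I_m) (X : {set 'I_m}) : nat :=
  #|[set y in X :\ x | prefers s x y]|.

Definition U_in (R : realType) m (b : {ffun {perm 'I_m} -> R}) (x : 'I_m)
  (X : {set 'I_m}) : R :=
  \sum_(s : {perm 'I_m}) b s * (u_in s x X)%:R.

Definition is_profile (R : realType) m (P : {ffun {perm 'I_m} -> R}) : Prop :=
  (forall s, 0 <= P s <= 1) /\ \sum_(s : {perm 'I_m}) P s = 1.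

Definition is_subprofile (R : realType) m (P S : {ffun {perm 'I_m} -> R}) : Prop :=
  forall s, 0 <= S s <= 1 /\ S s <= P s.

Definition mass (R : realType) m (S : {ffun {perm 'I_m} -> R}) : R :=
  \sum_(s : {perm 'I_m}) S s.

(* A flow in the network G_x (for current weights b and remaining set X):
   fs s = flow on (source, v_s), fm (s,y) = flow on (v_s, v_y),
   ft y = flow on (v_y, sink).  Non-existing edges / vertices carry 0. *)
Record flow (R : realType) m := Flow {
  fs : {ffun {perm 'I_m} -> R};
  fm : {ffun {perm 'I_m} * 'I_m -> R};
  ft : {ffun 'I_m -> R} }.

Definition is_flow (R : realType) m (b : {ffun {perm 'I_m} -> R}) (x : 'I_m)
  (X : {set 'I_m}) (f : flow R m) : Prop :=
  (forall s, 0 <= fs f s <= b s) /\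
  (forall s y, 0 <= fm f (s, y)) /\
  (forall s y, ~~ ((y \in X :\ x) && prefers s x y) -> fm f (s, y) = 0) /\
  (forall y, 0 <= ft f y <= 1) /\
  (forall y, y \notin X :\ x -> ft f y = 0) /\
  (forall s, fs f s = \sum_(y : 'I_m) fm f (s, y)) /\
  (forall y, ft f y = \sum_(s : {perm 'I_m}) fm f (s, y)).

Definition flow_value (R : realType) m (f : flow R m) : R :=
  \sum_(s : {perm 'I_m}) fs f s.

Definition is_max_flow (R : realType) m b x X (f : flow R m) : Prop :=
  is_flow b x X f /\ forall g, is_flow b x X g -> flow_value g <= flow_value f.

(* max_s f(s,v_s) / (b(s) u(s,x,X)); in MathComp 0^-1 = 0, so 0/0 = 0. *)
Definition max_ratio (R : realType) m (b : {ffun {perm 'I_m} -> R}) x X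
  (f : flow R m) : R :=
  \big[Num.max/0]_(s : {perm 'I_m}) (fs f s / (b s * (u_in s x X)%:R)).

Definition is_fair_max_flow (R : realType) m b x X (f : flow R m) : Prop :=
  is_max_flow b x X f /\
  forall g, is_max_flow b x X g -> max_ratio b x X f <= max_ratio b x X g.

(* t is a possible output of the Flow-adjusting Borda rule on P (for some
   resolution of ties and some admissible choice of flows).  Round i+1 of the
   paper is index i here; b i is b_{i+1} of the paper; the candidate placed in
   round i is the x with t x = i; X_i = candidates not yet placed. *)
Definition FAB_outcome (R : realType) m (P : {ffun {perm 'I_m} -> R})
  (t : {perm 'I_m}) : Prop :=
  exists b : nat -> {ffun {perm 'I_m} -> R},
    (forall s, b 0%N s = P s * ('C(m, 2))%:R) /\
    forall (i : nat) (x : 'I_m), (t x : nat) = i ->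
      let X := [set y : 'I_m | (i <= t y)%N] in
      (forall y, y \in X -> U_in (b i) y X <= U_in (b i) x X) /\
      exists f : flow R m, is_fair_max_flow (b i) x X f /\
        forall s, b i.+1 s = b i s - fs f s.

(* Main.v *)
(** The group S owns the fraction share s = S s / P s of the budget of every
    voter.  With B the total budget and n candidates left, comparing the Borda
    score of the winner x with the average score over x |: Y gives Hall's
    condition for payments at most (2 / B) b(s) u(s, x, X).  Hence for n >= 4
    a fair maximum flow saturates the sink (so B stays equal to 'C(n, 2)) and
    satisfies B f(s) <= 2 b(s) u(s, x, X): the square of the group budget drops
    by at most 4 'C(m, 2) times the utility gained by the group.  The rounds with
    n = 3 and n = 2 each at least halve the total budget, from 3 down to 3/4,
    and the trivial bound f(s) <= b(s) u(s, x, X) pays for the rest.  The final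
    3/16 is 3/4 * 1/4. *)

Require Import Defs.
From HB Require Import structures.
From mathcomp Require Import all_boot all_order all_algebra all_fingroup.
From mathcomp Require Import reals.
From mathcomp Require Import zify ring lra.
Set Implicit Arguments. Unset Strict Implicit. Unset Printing Implicit Defensive.
Import Order.TTheory GRing.Theory Num.Theory.
Local Open Scope ring_scope.

(** * Fractional Hall theorem for bipartite supply and demand *)

Section FractionalHall.
Variables (R : realFieldType) (I J : finType).
Implicit Types (e : {set I * J}) (Y : {set J}) (c : I -> R) (d : J -> R).

Definition nbrs e Y : {set I} := [set s | [exists y in Y, (s, y) \in e]].

Definition hall e c d :=
  forall Y, \sum_(y in Y) d y <= \sum_(s in nbrs e Y) c s.

Lemma nbrsP e Y s : reflect (exists2 y, y \in Y & (s, y) \in e) (s \in nbrs e Y).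
Proof. by rewrite inE; apply: exists_inP. Qed.

Lemma nbrsU e Y Y' : nbrs e (Y :|: Y') = nbrs e Y :|: nbrs e Y'.
Proof.
apply/setP => s; rewrite in_setU; apply/nbrsP/orP.
  by case=> y /setUP[] yY ye; [left | right]; apply/nbrsP; exists y.
by case=> /nbrsP[y yY ye]; exists y => //; rewrite inE yY ?orbT.
Qed.

Lemma nbrsS e Y Y' : Y \subset Y' -> nbrs e Y \subset nbrs e Y'.
Proof.
by move=> /subsetP sY; apply/subsetP => s /nbrsP[y /sY ? ?]; apply/nbrsP; exists y.
Qed.

Lemma nbrs_del e Y s y r :
  (r != s) || (y \notin Y) -> (r \in nbrs (e :\ (s, y)) Y) = (r \in nbrs e Y).
Proof.
move=> ry; apply/nbrsP/nbrsP => -[z zY].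
  by rewrite !inE => /andP[_ ?]; exists z.
move=> ze; exists z => //; rewrite !inE ze andbT xpair_eqE negb_and.
by case/orP: ry => [-> // | yY]; apply/orP; right; apply: contraNneq yY => <-.
Qed.

Lemma ler_sum_setS (K : finType) (c : K -> R) (A B : {set K}) :
  (forall s, 0 <= c s) -> A \subset B ->
  \sum_(s in A) c s <= \sum_(s in B) c s.
Proof.
move=> c0 /subsetP AB; rewrite [leLHS]big_mkcond [leRHS]big_mkcond /=.
by apply: ler_sum => s _; case: ifP => [/AB-> | _] //; case: ifP.
Qed.

Lemma sum_setUI (K : finType) (c : K -> R) (A B : {set K}) :
  \sum_(s in A) c s + \sum_(s in B) c s =
  \sum_(s in A :|: B) c s + \sum_(s in A :&: B) c s.
Proof.
rewrite 4![\sum_(_ in _) _]big_mkcond -!big_split /=; apply: eq_bigr => s _.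
by rewrite !inE; case: (s \in A); case: (s \in B); rewrite /= ?addr0 ?add0r.
Qed.

Lemma sum_if_eq (K : finType) (A : {set K}) (a : K) (x : R) :
  \sum_(r in A) (if r == a then x else 0) = if a \in A then x else 0.
Proof.
have [aA | aA] := boolP (a \in A); last first.
  by rewrite big1 // => r rA; case: eqP => // ra; rewrite -ra rA in aA.
by rewrite (big_setD1 a) //= eqxx big1 ?addr0 // => r; rewrite !inE => /andP[/negbTE->].
Qed.

Lemma hall_del_supply e c d s y : hall e c d -> c s = 0 -> hall (e :\ (s, y)) c d.
Proof.
move=> H cs Y; apply: le_trans (H Y) _.
rewrite [leLHS]big_mkcond [leRHS]big_mkcond /=; apply: ler_sum => r _.
have [-> | rs] := eqVneq r s; first by rewrite cs !if_same.
by rewrite nbrs_del ?rs.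
Qed.

(** As [y] demands nothing, it may be dropped from [Y], and the neighbourhood of the remaining set
    does not use the edge [(s, y)]. *)
Lemma hall_del_demand e c d s y :
  (forall s, 0 <= c s) -> hall e c d -> d y = 0 -> hall (e :\ (s, y)) c d.
Proof.
move=> c0 H dy Y.
have -> : \sum_(z in Y) d z = \sum_(z in Y :\ y) d z.
  have [yY | yY] := boolP (y \in Y); first by rewrite (big_setD1 y) //= dy add0r.
  by rewrite (setDidPl _) // disjoint_sym disjoints1.
apply: le_trans (H _) _; apply: ler_sum_setS => //.
apply: (subset_trans (B := nbrs (e :\ (s, y)) (Y :\ y))); last by apply/nbrsS/subD1set.
by apply/subsetP => r; rewrite nbrs_del // setD11 orbT.
Qed.

(* Uncrossing: an edge leaving the demands of a tight set carries no flow. *)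
Lemma hall_del_tight e c d s y Y :
  (forall s, 0 <= c s) -> hall e c d -> y \notin Y -> s \in nbrs e Y ->
  \sum_(s in nbrs e Y) c s <= \sum_(z in Y) d z -> hall (e :\ (s, y)) c d.
Proof.
move=> c0 H yY sY tight Z.
have := lerD (H (Y :|: Z)) (H (Y :&: Z)); rewrite -sum_setUI => h.
set e' := e :\ _.
(* Since [s] is a neighbour of [Y], deleting the edge does not shrink the union of the two
   neighbourhoods; since [y] is not in [Y], it does not affect [Y :&: Z]. Tightness of [Y] then
   cancels its terms. *)
suff : \sum_(r in nbrs e (Y :|: Z)) c r + \sum_(r in nbrs e (Y :&: Z)) c r <=
       \sum_(r in nbrs e Y) c r + \sum_(r in nbrs e' Z) c r by lra.
rewrite [leRHS]sum_setUI; apply: lerD; apply: ler_sum_setS => //.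
  rewrite nbrsU; apply/subsetP => r; rewrite !in_setU.
  by have [-> | rs] := eqVneq r s; [rewrite sY | rewrite nbrs_del ?rs].
apply/subsetP => r rYZ; rewrite in_setI (subsetP (nbrsS e (subsetIl Y Z))) //=.
have yYZ : y \notin Y :&: Z by rewrite in_setI negb_and yY.
move: rYZ; rewrite -(@nbrs_del _ _ s y) ?yYZ ?orbT //.
exact/subsetP/nbrsS/subsetIr.
Qed.

(** Induction on the number of edges: send along one edge [(s, y)] the largest amount [eps] that
    preserves Hall's condition. Then [s] is exhausted, [y] is satisfied, or some set avoiding [y] is
    tight; in each case the edge can be deleted. *)
Lemma fractional_hall e c d :
  (forall s, 0 <= c s) -> (forall y, 0 <= d y) -> hall e c d ->
  exists h : I -> J -> R,
    [/\ forall s y, 0 <= h s y, forall s y, (s, y) \notin e -> h s y = 0,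
        forall y, \sum_s h s y = d y & forall s, \sum_y h s y <= c s].
Proof.
have [n] := ubnP #|e|; elim: n e c d => // n IH e c d /ltnSE len c0 d0 H.
have [e0 | [[s y] sye]] := set_0Vmem e.
  exists (fun _ _ => 0); split => // z; rewrite big1 //.
  (* Without edges, Hall's condition at a singleton forces its demand to be zero. *)
  have := H [set z]; rewrite big_set1 big_pred0 => [dz|s].
    by apply/eqP; rewrite eq_le d0 dz.
  by apply/negP => /nbrsP[? _]; rewrite e0 inE.
pose slack Y := \sum_(s in nbrs e Y) c s - \sum_(z in Y) d z.
have slack0 Y : 0 <= slack Y by rewrite subr_ge0.
(* Lowering [c s] and [d y] by the same amount can break Hall's condition only at sets that omit [y]
   but have [s] as a neighbour, so only these contribute their slack to the minimum. *)
pose F Y := if (y \notin Y) && (s \in nbrs e Y)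
  then Num.min (Num.min (c s) (d y)) (slack Y) else Num.min (c s) (d y).
have [Y0 _ minY0] := @Order.TotalTheory.arg_minP _ _ _ (set0 : {set J}) xpredT F isT.
set eps := F Y0 in minY0.
have eps0 : 0 <= eps.
  by rewrite /eps /F; case: ifP => _; rewrite !le_min ?c0 ?d0 ?slack0.
have eps_min : eps <= Num.min (c s) (d y).
  by apply: le_trans (minY0 set0 isT) _; rewrite /F; case: ifP => _ //; rewrite ge_min lexx.
have [eps_c eps_d] : eps <= c s /\ eps <= d y.
  by move: eps_min; rewrite le_min => /andP[].
have eps_slack Y : y \notin Y -> s \in nbrs e Y -> eps <= slack Y.
  move=> yY sY; apply: le_trans (minY0 Y isT) _.
  by rewrite /F yY sY /= ge_min lexx orbT.
pose c' r := c r - (if r == s then eps else 0).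
pose d' z := d z - (if z == y then eps else 0).
have c'0 r : 0 <= c' r.
  by rewrite /c'; case: eqP => [->|_]; rewrite ?subr0 // subr_ge0.
have d'0 z : 0 <= d' z.
  by rewrite /d'; case: eqP => [->|_]; rewrite ?subr0 // subr_ge0.
have sumc (A : {set I}) :
    \sum_(r in A) c' r = \sum_(r in A) c r - (if s \in A then eps else 0).
  by rewrite sumrB sum_if_eq.
have sumd (A : {set J}) :
    \sum_(r in A) d' r = \sum_(r in A) d r - (if y \in A then eps else 0).
  by rewrite sumrB sum_if_eq.
have H' : hall e c' d'.
  move=> Y; rewrite sumc sumd; have HY := H Y.
  have [yY | yY] := boolP (y \in Y).
    have -> : s \in nbrs e Y by apply/nbrsP; exists y.
    by rewrite lerB.
  have [sY | sY] := boolP (s \in nbrs e Y); last by rewrite !subr0.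
  by have := eps_slack _ yY sY; rewrite /slack; lra.
have H'' : hall (e :\ (s, y)) c' d'.
  have cs : eps = c s -> hall (e :\ (s, y)) c' d'.
    by move=> E; apply: hall_del_supply => //; rewrite /c' eqxx E subrr.
  have dy : eps = d y -> hall (e :\ (s, y)) c' d'.
    by move=> E; apply: hall_del_demand => //; rewrite /d' eqxx E subrr.
  have cd : eps = Num.min (c s) (d y) -> hall (e :\ (s, y)) c' d'.
    by rewrite minEle; case: ifP => _.
  have [/andP[yY sY] | nY] := boolP ((y \notin Y0) && (s \in nbrs e Y0)); last first.
    by apply: cd; rewrite /eps /F (negbTE nY).
  have : eps = Num.min (Num.min (c s) (d y)) (slack Y0) by rewrite /eps /F yY sY.
  rewrite [RHS]minEle; case: ifP => _; first exact: cd.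
  move=> E; apply: (@hall_del_tight _ _ _ _ _ Y0) => //.
  by rewrite sumc sumd sY (negbTE yY) E /slack; lra.
have /IH /(_ c'0 d'0 H'')[h [h0 he hd hc]] : (#|e :\ (s, y)| < n)%N.
  by move: len; rewrite (cardsD1 (s, y) e) sye.
exists (fun r z => h r z + (if (r == s) && (z == y) then eps else 0)); split.
- by move=> r z; rewrite addr_ge0 //; case: ifP.
- move=> r z rze; rewrite he ?add0r ?inE ?(negbTE rze) ?andbF //.
  by case: ifP => // /andP[/eqP rs /eqP zy]; rewrite rs zy sye in rze.
- move=> z; rewrite big_split /= hd /d'; have [-> | zy] := eqVneq z y.
    under eq_bigr do rewrite andbT.
    by rewrite -big_mkcond /= big_pred1_eq subrK.
  by rewrite big1 ?addr0 ?subr0 // => r _; rewrite andbF.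
move=> r; rewrite big_split /=; move: (hc r); rewrite /c'.
have [-> | rs] := eqVneq r s.
  by rewrite /= -big_mkcond /= big_pred1_eq; lra.
by rewrite subr0 => hr; rewrite [X in _ + X]big1 ?addr0.
Qed.

End FractionalHall.

(** * Borda counting and Hall's condition at a Borda winner *)

Section Borda.
Variables (m : nat).
Implicit Types (s t : {perm 'I_m}) (x y z : 'I_m) (X Y Z : {set 'I_m}).

Lemma prefers_antisym s x y : x != y -> prefers s x y = ~~ prefers s y x.
Proof.
move=> xy; rewrite /prefers -leqNgt ltn_neqAle.
by rewrite (inj_eq val_inj) (inj_eq perm_inj) xy.
Qed.

Lemma u_inE s x X : u_in s x X = (\sum_(y in X :\ x) prefers s x y)%N.
Proof.
rewrite /u_in -sum1_card big_mkcond [RHS]big_mkcond /=; apply: eq_bigr => y _.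
by rewrite inE; case: (y \in X :\ x) => //=; case: prefers.
Qed.

Lemma u_in_le_card s x X : (u_in s x X <= #|X :\ x|)%N.
Proof. by apply/subset_leq_card/subsetP => y; rewrite inE => /andP[]. Qed.

Lemma u_in_gt0 s x y X : y \in X :\ x -> prefers s x y -> (0 < u_in s x X)%N.
Proof. by move=> yX xy; apply/card_gt0P; exists y; rewrite inE yX. Qed.

Lemma u_inS s x X Z : Z \subset X -> (u_in s x Z <= u_in s x X)%N.
Proof.
move=> /subsetP ZX; apply/subset_leq_card/subsetP => y; rewrite !inE.
by case/andP => /andP[-> /ZX->].
Qed.

(** Adding the double sum to its transpose counts each ordered pair of distinct elements of [Z]
    exactly once. *)
Lemma sum_u_in s Z : (2 * \sum_(z in Z) u_in s z Z = #|Z| * #|Z|.-1)%N.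
Proof.
pose r x y : nat := (y != x) && prefers s x y.
have uE z : (u_in s z Z = \sum_(y in Z) r z y)%N.
  rewrite u_inE /r big_mkcond [RHS]big_mkcond /=; apply: eq_bigr => y _.
  by rewrite !inE; case: eqP; case: (y \in Z).
rewrite mul2n -addnn (eq_bigr _ (fun z _ => uE z)).
rewrite [X in (_ + X)%N]exchange_big -big_split /= -sum_nat_const.
apply: eq_bigr => z zZ; rewrite -big_split /= (bigD1 z) //= {1 2}/r eqxx /=.
have -> : #|Z|.-1 = (\sum_(y in Z | y != z) 1)%N.
  by rewrite (cardsD1 z Z) zZ -sum1_card; apply: eq_bigl => y; rewrite !inE andbC.
apply: eq_bigr => y /andP[_ yz]; rewrite /r yz eq_sym yz /=.
by rewrite (prefers_antisym _ yz); case: prefers.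
Qed.

(* If x beats some element of Y, counting inside Z = x |: Y suffices.
   Otherwise every z in Z beats all that x beats in X, which is disjoint from
   what z beats inside Z. *)
Lemma borda_hall_voter s x X Y : x \in X -> Y \subset X :\ x ->
  (2 * (#|Y|.+1 * u_in s x X) + #|Y|.+1 * #|Y| <=
   2 * \sum_(z in x |: Y) u_in s z X
   + 2 * (#|Y|.+1 * if [exists y in Y, prefers s x y] then u_in s x X else 0))%N.
Proof.
move=> xX YX; have xY : x \notin Y by apply: contraTN (xX) => /(subsetP YX); rewrite !inE eqxx.
have cZ : #|x |: Y| = #|Y|.+1 by rewrite cardsU1 xY.
have ZX : x |: Y \subset X.
  by rewrite subUset sub1set xX (subset_trans YX) // subD1set.
have := sum_u_in s (x |: Y); rewrite cZ /= => <-.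
case: ifP => [_ | /negbT nY].
  rewrite addnC leq_add2r leq_mul2l /=; apply: leq_sum => z _; exact: u_inS.
rewrite muln0 muln0 addn0 -mulnDr leq_mul2l /= -cZ -sum_nat_const -big_split /=.
apply: leq_sum => z zZ.
have xz : (s z <= s x)%N.
  move: zZ; rewrite !inE => /orP[/eqP-> // | zY].
  move: nY; rewrite negb_exists => /forallP/(_ z); rewrite zY /= /prefers.
  by rewrite -leqNgt.
rewrite /u_in -cardsUI addnC.
set A := [set _ in _ | _]; set B := [set _ in _ | _].
have -> : A :&: B = set0.
  apply/setP => y; rewrite !inE; apply/negP => /andP[/andP[/andP[yx yX] xy]].
  case/andP => /andP[yz]; case/orP => [yx' | yY] _; first by rewrite yx' in yx.
  by move: nY => /existsP[]; exists y; rewrite yY.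
rewrite cards0 add0n; apply/subset_leq_card/subsetP => y.
rewrite !inE => /orP[/andP[/andP[yx ->] xy] | /andP[/andP[-> yZ] ->]].
  have zy : prefers s z y by apply: leq_ltn_trans xy.
  by rewrite zy !andbT; apply: contraTneq zy => ->; rewrite /prefers ltnn.
by rewrite !andbT /=; apply: (subsetP ZX); rewrite !inE.
Qed.

(** The voter inequality is summed with weights [b]. The score of [x] is at least the average over
    [x |: Y], so the score terms cancel and a common factor [#|Y| + 1] remains to be divided out. *)
Lemma borda_hall (R : realType) (b : {ffun {perm 'I_m} -> R}) x X Y :
  (forall s, 0 <= b s) -> x \in X -> Y \subset X :\ x ->
  (forall y, y \in X -> U_in b y X <= U_in b x X) ->
  mass b * #|Y|%:R / 2 <=
  \sum_(s | [exists y in Y, prefers s x y]) b s * (u_in s x X)%:R.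
Proof.
move=> b0 xX YX winner; set W := \sum_(_ | _) _.
have xY : x \notin Y by apply: contraTN (xX) => /(subsetP YX); rewrite !inE eqxx.
pose k : R := #|Y|%:R; have k0 : 0 <= k by rewrite ler0n.
have le_avg : \sum_(z in x |: Y) U_in b z X <= (k + 1) * U_in b x X.
  apply: (le_trans (y := \sum_(z in x |: Y) U_in b x X)).
    apply: ler_sum => z; rewrite !inE => /orP[/eqP-> // | zY]; apply: winner.
    by move: (subsetP YX _ zY); rewrite !inE => /andP[].
  by rewrite sumr_const cardsU1 xY -mulr_natl natrD addrC lexx.
have : 2 * (k + 1) * U_in b x X + (k + 1) * k * mass b <=
   2 * \sum_(z in x |: Y) U_in b z X + 2 * (k + 1) * W.
  rewrite /U_in exchange_big /= /mass /W [X in _ <= _ + _ * X]big_mkcond /=.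
  rewrite !mulr_sumr -!big_split /=; apply: ler_sum => s _.
  rewrite -mulr_sumr -natr_sum.
  have := borda_hall_voter s xX YX; rewrite -(ler_nat R).
  rewrite !natrD !natrM -!natr1 -/k => /(ler_wpM2l (b0 s)).
  case: ifP => _ H; lra.
move=> H; have : (k + 1) * (mass b * k) <= (k + 1) * (2 * W) by lra.
rewrite ler_pM2l; last by lra.
by rewrite -/k; lra.
Qed.

End Borda.

(** * Flows in the network of one round *)

Section Rounds.
Variables (R : realType) (m : nat).
Implicit Types (s t : {perm 'I_m}) (x y z : 'I_m) (X Y : {set 'I_m}).
Implicit Types (b c : {ffun {perm 'I_m} -> R}) (f g : flow R m).

Lemma sum_const_if (T : finType) (A B : {set T}) (a : R) :
  \sum_(y in A) (if y \in B then a else 0) = a * #|A :&: B|%:R.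
Proof.
rewrite -big_mkcondr /= mulr_natr -sumr_const.
by apply: eq_bigl => y; rewrite inE.
Qed.

(** Fractional Hall with demand [a] at every remaining rival of [x] and supply [c s] at voter [s].
    Taking [c] below [b] yields flows with prescribed bounds on the payments. *)
Lemma flow_exists b (c : {perm 'I_m} -> R) x X (a : R) :
  (forall s, 0 <= c s <= b s) -> 0 <= a <= 1 ->
  (forall Y, Y \subset X :\ x ->
     a * #|Y|%:R <= \sum_(s | [exists y in Y, prefers s x y]) c s) ->
  exists g, [/\ is_flow b x X g, forall s, fs g s <= c s &
                flow_value g = a * #|X :\ x|%:R].
Proof.
move=> cb /andP[a0 a1] H.
pose e := [set p : {perm 'I_m} * 'I_m | (p.2 \in X :\ x) && prefers p.1 x p.2].
pose d y := if y \in X :\ x then a else 0.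
have c0 s : 0 <= c s by case/andP: (cb s).
have d0 y : 0 <= d y by rewrite /d; case: ifP.
have He : hall e c d.
  move=> Y; rewrite sum_const_if; apply: le_trans (H _ (subsetIr _ _)) _.
  rewrite (eq_bigl (mem (nbrs e Y))) // => s; apply/exists_inP/nbrsP => -[y].
    by rewrite in_setI => /andP[yY yX] xy; exists y => //; rewrite inE yX.
  by move=> yY; rewrite inE => /andP[yX xy]; exists y; rewrite // in_setI yY.
have [h [h0 he hd hc]] := fractional_hall c0 d0 He.
exists (Flow [ffun s => \sum_y h s y] [ffun p => h p.1 p.2] [ffun y => d y]).
split=> [|s|]; rewrite /flow_value /= ?ffunE //.
- do !split => /=.
  + move=> s; rewrite ffunE sumr_ge0 //=.
    by apply: le_trans (hc s) _; case/andP: (cb s).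
  + by move=> s y; rewrite ffunE.
  + by move=> s y nsy; rewrite ffunE /= he // inE.
  + by move=> y; rewrite ffunE d0 /d /=; case: ifP => _; rewrite ?ler01.
  + by move=> y /negbTE yX; rewrite ffunE /d yX.
  + by move=> s; rewrite ffunE; apply: eq_bigr => y _; rewrite ffunE.
  + by move=> y; rewrite ffunE -hd; apply: eq_bigr => s _; rewrite ffunE.
under eq_bigr do rewrite ffunE.
rewrite exchange_big /= (eq_bigr _ (fun y _ => hd y)).
by rewrite /d -big_mkcond /= sumr_const mulr_natr.
Qed.

Section Flow.
Variables (b : {ffun {perm 'I_m} -> R}) (x : 'I_m) (X : {set 'I_m}) (f : flow R m).
Hypothesis flow_f : is_flow b x X f.

Lemma flow_fs_bounds s : 0 <= fs f s <= b s.
Proof. by case: flow_f. Qed.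

Lemma flow_value_le_card : flow_value f <= #|X :\ x|%:R.
Proof.
case: flow_f => _ [_ [_ [ft1 [ft0 [fsE ftE]]]]].
rewrite /flow_value (eq_bigr _ (fun s _ => fsE s)) exchange_big /=.
rewrite -(eq_bigr _ (fun y _ => ftE y)) -sum1_card natr_sum big_mkcond /=.
rewrite [leRHS]big_mkcond /=; apply: ler_sum => y _.
by case: ifPn => [_ | /ft0->] //; case/andP: (ft1 y).
Qed.

Lemma flow_fs_eq0 s : u_in s x X = 0%N -> fs f s = 0.
Proof.
case: flow_f => _ [_ [fm0 [_ [_ [fsE _]]]]] u0; rewrite fsE big1 // => y _.
by apply: fm0; apply/negP => /andP[/u_in_gt0 H /H]; rewrite u0.
Qed.

(** A voter with utility 0 has no outgoing edge; otherwise the utility is at least 1 and the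
    capacity [b s] already gives the bound. *)
Lemma flow_fs_le_util s : fs f s <= b s * (u_in s x X)%:R.
Proof.
have /andP[f0 fb] := flow_fs_bounds s.
have [u0 | u0] := posnP (u_in s x X); first by rewrite flow_fs_eq0 // u0 mulr0.
apply: le_trans (fb) _; apply: ler_peMr; first exact: le_trans fb.
by rewrite ler1n.
Qed.

End Flow.

(** Where the denominator vanishes the flow vanishes too, so the convention 0/0 = 0 loses
    nothing. *)
Lemma flow_fs_le_ratio b x X f s :
  is_flow b x X f -> fs f s <= max_ratio b x X f * (b s * (u_in s x X)%:R).
Proof.
move=> flow_f; have /andP[f0 fb] := flow_fs_bounds flow_f s.
set v := b s * _; have v0 : 0 <= v by rewrite mulr_ge0 // (le_trans f0).
have [v_eq0 | v_neq0] := eqVneq v 0.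
  by rewrite v_eq0 mulr0 -v_eq0; apply: flow_fs_le_util.
rewrite -ler_pdivrMr; last by rewrite lt0r v_neq0.
exact: (le_bigmax 0 (fun r => fs f r / (b r * (u_in r x X)%:R)) s).
Qed.

Lemma max_ratio_le b x X f (a : R) : 0 <= a -> (forall s, 0 <= b s) ->
  (forall s, fs f s <= a * (b s * (u_in s x X)%:R)) -> max_ratio b x X f <= a.
Proof.
move=> a0 b0 H; apply: bigmax_le => // s _.
have [v_eq0 | v_neq0] := eqVneq (b s * (u_in s x X)%:R) 0.
  by rewrite v_eq0 invr0 mulr0.
by rewrite ler_pdivrMr // lt0r v_neq0 mulr_ge0.
Qed.

(** * Payments in a round won by a Borda winner *)

Section Round.
Variables (b : {ffun {perm 'I_m} -> R}) (x : 'I_m) (X : {set 'I_m}).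
Hypotheses (b0 : forall s, 0 <= b s) (xX : x \in X).
Hypothesis winner : forall y, y \in X -> U_in b y X <= U_in b x X.

(** By [borda_hall], the capacities [2 / mass b * (b s * u_in s x X)] admit a flow [g] that
    saturates the sink. Hence every maximum flow saturates it, and fairness against [g] bounds the
    ratio of [f] by [2 / mass b]. *)
Lemma round_proportional f : (3 <= #|X :\ x|)%N ->
  mass b * 2 = (#|X :\ x| * #|X :\ x|.+1)%:R -> is_fair_max_flow b x X f ->
  flow_value f = #|X :\ x|%:R /\
  forall s, mass b * fs f s <= 2 * (b s * (u_in s x X)%:R).
Proof.
set n := #|_|; move=> n3 massb [[flow_f max_f] fair].
have n3R : 3 <= n%:R :> R by rewrite ler_nat.
have massE : mass b * 2 = n%:R * (n%:R + 1) by rewrite massb natrM -natr1.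
have B0 : 0 < mass b by nra.
pose c s := 2 / mass b * (b s * (u_in s x X)%:R).
have a0 : 0 <= 2 / mass b by rewrite divr_ge0 // ltW.
(* Three rivals are needed here: the utility is at most [n] and the budget is [n (n + 1) / 2], so
   the factor of [b s] is at most [4 / (n + 1)], which is at most 1. *)
have cb s : 0 <= c s <= b s.
  apply/andP; split; first by apply: mulr_ge0 => //; apply: mulr_ge0.
  have -> : c s = b s * ((u_in s x X)%:R * 2) / mass b by rewrite /c; ring.
  rewrite ler_pdivrMr // ler_wpM2l //.
  have : (u_in s x X)%:R <= n%:R :> R by rewrite ler_nat u_in_le_card.
  nra.
have [|Y YX|g [flow_g gc g_val]] := @flow_exists b c x X 1 cb.
  by rewrite ler01 lexx.
  rewrite -mulr_sumr mul1r -(ler_pM2l B0) mulrA mulrCA divff ?gt_eqF // mulr1.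
  by have := borda_hall b0 xX YX winner; lra.
have max_g : is_max_flow b x X g.
  split=> // h flow_h; rewrite g_val mul1r; exact: flow_value_le_card flow_h.
split=> [|s].
  apply/eqP; rewrite eq_le (flow_value_le_card flow_f) /=.
  by have := max_f _ flow_g; rewrite g_val mul1r.
have := flow_fs_le_ratio s flow_f.
have : max_ratio b x X f <= 2 / mass b.
  by apply: le_trans (fair _ max_g) _; apply: max_ratio_le.
have v0 : 0 <= b s * (u_in s x X)%:R by rewrite mulr_ge0.
move=> /(ler_wpM2r v0) ratio /le_trans/(_ ratio).
by rewrite mulrAC ler_pdivlMr // mulrC.
Qed.

(* A uniform demand of [mass b / (2 |X \ x|)] can be met, as [u_in s x X <= |X \ x|]. *)
Lemma round_halves f : (0 < #|X :\ x|)%N -> mass b <= 2 * #|X :\ x|%:R ->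
  is_max_flow b x X f -> mass b / 2 <= flow_value f.
Proof.
set n := #|_|; move=> n0 massb [flow_f max_f].
have n0R : 0 < n%:R :> R by rewrite ltr0n.
have B0 : 0 <= mass b by apply: sumr_ge0.
have [s|||g [flow_g _ g_val]] := @flow_exists b b x X (mass b / (2 * n%:R)).
- by rewrite b0 lexx.
- by rewrite divr_ge0 ?ler_pdivrMr ?mul1r //; lra.
- move=> Y YX; rewrite mulrAC ler_pdivrMr; last by lra.
  have := borda_hall b0 xX YX winner.
  suff : \sum_(s | [exists y in Y, prefers s x y]) b s * (u_in s x X)%:R
      <= (\sum_(s | [exists y in Y, prefers s x y]) b s) * n%:R by lra.
  rewrite mulr_suml; apply: ler_sum => s _.
  by rewrite ler_wpM2l // ler_nat u_in_le_card.
apply: le_trans (max_f _ flow_g); rewrite g_val le_eqVlt; apply/orP; left.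
by apply/eqP; field; rewrite gt_eqF.
Qed.

End Round.
End Rounds.

(** * Agreement as a sum over rounds, and the closing arithmetic *)

(** Agreeing pairs are grouped by their upper candidate [x]: the candidates that [t] ranks below [x]
    are those still left, besides [x], when it is placed. *)
Lemma u_agreeE m (s t : {perm 'I_m}) :
  u_agree s t = (\sum_x u_in s x [set y | (t x <= t y)%N])%N.
Proof.
rewrite /u_agree -sum1_card big_mkcond /=.
under eq_bigr do rewrite inE.
rewrite -(pair_bigA _ (fun x y => if prefers s x y && prefers t x y then 1%N else 0%N)) /=.
apply: eq_bigr => x _; rewrite u_inE [RHS]big_mkcond /=; apply: eq_bigr => y _.
rewrite !inE; have [-> | yx] := eqVneq y x; first by rewrite /prefers !ltnn.
rewrite {2}/prefers ltn_neqAle (inj_eq val_inj) (inj_eq perm_inj) eq_sym yx /=.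
by case: (t x <= t y)%N; case: prefers.
Qed.

(** Here [C * Q] is the initial group budget, [z] and [e] are the group budgets after the quadratic
    and the linear phase, and [Uz], [Ue], [U] are the utilities then and at the end. *)
Lemma two_phase_bound (R : realFieldType) (C Q z e Uz Ue U : R) :
  1 <= C -> (C * Q) ^+ 2 - z ^+ 2 <= 4 * C * Uz -> z - e <= C * (Ue - Uz) ->
  0 <= z -> z <= 3 -> z <= C * Q -> e <= 3 / 4 -> Uz <= Ue -> Ue <= U ->
  Q * (C * Q / 4 - 3 / 16) <= U.
Proof.
move=> C1 quad lin z0 z3 zCQ e34 Uze UeU.
have Cp : 0 < 4 * C by lra.
have C_ze : 0 <= C * (Ue - Uz) by rewrite mulr_ge0 ?subr_ge0 //; lra.
have C_e : 0 <= C * (U - Ue) by rewrite mulr_ge0 ?subr_ge0 //; lra.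
rewrite -(ler_pM2l Cp).
have -> : 4 * C * (Q * (C * Q / 4 - 3 / 16)) = (C * Q) ^+ 2 - 3 / 4 * (C * Q) by field.
(* For small [z] the linear phase is ignored, as [z ^+ 2 <= 3 / 4 * z]. Otherwise
   [z ^+ 2 - 4 * z + 3 <= 3 / 4 * z] is needed, which factors with roots 3/4 and 4. *)
have [z_small | z_big] := leP z (3 / 4).
  have : 0 <= z * (3 / 4 - z) by rewrite mulr_ge0 ?subr_ge0.
  by lra.
have : 0 <= (z - 3 / 4) * (4 - z) by rewrite mulr_ge0 //; lra.
by lra.
Qed.

(** * Budget and utility of a group over all rounds *)

Section Outcome.
Variables (R : realType) (m : nat) (P S : {ffun {perm 'I_m} -> R}).
Variables (t : {perm 'I_m}) (b : nat -> {ffun {perm 'I_m} -> R}).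
Implicit Types (s : {perm 'I_m}) (x : 'I_m).

Let C : R := 'C(m, 2)%:R.
Let rest (k : nat) : {set 'I_m} := [set y | (k <= t y)%N].

Hypotheses (profile_P : is_profile P) (subprofile_S : is_subprofile P S).
Hypothesis b_init : forall s, b 0%N s = P s * C.
Hypothesis round : forall k x, (t x : nat) = k ->
  (forall y, y \in rest k -> U_in (b k) y (rest k) <= U_in (b k) x (rest k)) /\
  exists f : flow R m, is_fair_max_flow (b k) x (rest k) f /\
    forall s, b k.+1 s = b k s - fs f s.

Let share s : R := S s / P s.
Let group_budget k := \sum_s share s * b k s.
Let utility k := \sum_(x | (t x < k)%N) \sum_s S s * (u_in s x (rest (t x)))%:R.

Let share_bounds s : 0 <= share s <= 1.
Proof.
have [/andP[S0 _] SP] := subprofile_S s.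
rewrite /share divr_ge0 ?(le_trans S0 SP) //=.
have [P0 | P0] := eqVneq (P s) 0; first by rewrite P0 invr0 mulr0 ler01.
by rewrite ler_pdivrMr ?mul1r // lt0r P0 (le_trans S0 SP).
Qed.

(** If [P s = 0], division gives share 0, which is consistent because then [S s = 0]. *)
Let share_P s : share s * P s = S s.
Proof.
have [/andP[S0 _] SP] := subprofile_S s; rewrite /share.
have [P0 | P0] := eqVneq (P s) 0; last by rewrite divfK.
by apply/eqP; rewrite P0 mulr0 eq_sym eq_le S0 -P0 SP.
Qed.

Let mass_init : mass (b 0%N) = C.
Proof.
rewrite /mass; under eq_bigr do rewrite b_init.
by rewrite -mulr_suml; case: profile_P => _ ->; rewrite mul1r.
Qed.

Let group_budget_init : group_budget 0 = C * mass S.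
Proof.
rewrite /group_budget /mass mulr_sumr; apply: eq_bigr => s _.
by rewrite b_init mulrA share_P mulrC.
Qed.

Let in_rest x : x \in rest (t x).
Proof. by rewrite inE. Qed.

Let card_rest x : #|rest (t x) :\ x| = (m - (t x).+1)%N.
Proof.
have -> : rest (t x) :\ x = t @^-1: [set i : 'I_m | (t x < i)%N].
  apply/setP => y; rewrite !inE ltn_neqAle (inj_eq val_inj) (inj_eq perm_inj).
  by rewrite eq_sym.
rewrite card_preimset; last exact: perm_inj.
rewrite -sum1_card (eq_bigl (fun i : 'I_m => ((t x).+1 <= i)%N)) => [|i]; last by rewrite inE.
by rewrite -(big_geq_mkord _ _ (fun=> true) (fun=> 1%N)) sum_nat_const_nat muln1.
Qed.

Let exists_round k : (k < m)%N -> exists2 x, (t x : nat) = k &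
  (forall y, y \in rest k -> U_in (b k) y (rest k) <= U_in (b k) x (rest k)) /\
  exists f : flow R m, is_fair_max_flow (b k) x (rest k) f /\
    forall s, b k.+1 s = b k s - fs f s.
Proof.
move=> km; have tx : t ((t^-1)%g (Ordinal km)) = Ordinal km by rewrite permKV.
by exists ((t^-1)%g (Ordinal km)); [rewrite tx | apply: round; rewrite tx].
Qed.

Let b_ge0 k s : (k <= m)%N -> 0 <= b k s.
Proof.
elim: k => [_ | k IH km].
  by rewrite b_init mulr_ge0 //; case: profile_P => /(_ s)/andP[].
have [x _ [_ [f [[[flow_f _] _] ->]]]] := exists_round km.
by rewrite subr_ge0; case/andP: (flow_fs_bounds flow_f s).
Qed.

Let mass_step k f : (forall s, b k.+1 s = b k s - fs f s) ->
  mass (b k.+1) = mass (b k) - flow_value f.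
Proof. by move=> bE; rewrite /mass (eq_bigr _ (fun s _ => bE s)) sumrB. Qed.

Let group_budget_step k f : (forall s, b k.+1 s = b k s - fs f s) ->
  group_budget k - group_budget k.+1 = \sum_s share s * fs f s.
Proof.
by move=> bE; rewrite -sumrB; apply: eq_bigr => s _; rewrite bE; ring.
Qed.

Let utility_step x :
  utility (t x).+1 = utility (t x) + \sum_s S s * (u_in s x (rest (t x)))%:R.
Proof.
rewrite /utility (bigD1 x) //= addrC; congr (_ + _); apply: eq_bigl => y.
by rewrite ltnS [RHS]ltn_neqAle (inj_eq val_inj) (inj_eq perm_inj) andbC.
Qed.

Let b_antimono k s : (k <= m)%N -> b k s <= b 0%N s.
Proof.
elim: k => // k IH km; apply: le_trans (IH (ltnW km)).
have [x _ [_ [f [[[flow_f _] _] ->]]]] := exists_round km.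
by rewrite gerBl; case/andP: (flow_fs_bounds flow_f s).
Qed.

(** Budgets never grow, and initially the group owns exactly [C * S s] of the budget of [s]. *)
Let share_b k s : (k <= m)%N -> share s * b k s <= C * S s.
Proof.
move=> km; rewrite -(share_P s) mulrCA [C * _]mulrC -b_init.
by rewrite ler_wpM2l ?b_antimono //; case/andP: (share_bounds s).
Qed.

Let group_budget_ge0 k : (k <= m)%N -> 0 <= group_budget k.
Proof.
move=> km; apply: sumr_ge0 => s _; rewrite mulr_ge0 ?b_ge0 //.
by case/andP: (share_bounds s).
Qed.

Let group_budget_le_mass k : (k <= m)%N -> group_budget k <= mass (b k).
Proof.
move=> km; apply: ler_sum => s _; rewrite ler_piMl ?b_ge0 //.
by case/andP: (share_bounds s).
Qed.

Let step_linear k : (k < m)%N ->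
  group_budget k - group_budget k.+1 <= C * (utility k.+1 - utility k).
Proof.
move=> km; have [x <- [_ [f [[[flow_f _] _] bE]]]] := exists_round km.
rewrite (group_budget_step bE) utility_step addrC addKr mulr_sumr.
apply: ler_sum => s _; have /andP[sh0 _] := share_bounds s.
apply: le_trans (ler_wpM2l sh0 (flow_fs_le_util flow_f s)) _.
by rewrite !mulrA ler_wpM2r // share_b // ltnW.
Qed.

Let step_quadratic k : (k + 4 <= m)%N ->
  mass (b k) * 2 = ((m - k.+1) * (m - k.+1).+1)%:R ->
  mass (b k.+1) * 2 = ((m - k.+2) * (m - k.+2).+1)%:R /\
  group_budget k ^+ 2 - group_budget k.+1 ^+ 2 <= 4 * C * (utility k.+1 - utility k).
Proof.
move=> km massb; have km' : (k < m)%N by lia.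
have [x tx [winner [f [fair bE]]]] := exists_round km'.
have b0 s : 0 <= b k s by rewrite b_ge0 // ltnW.
have xX : x \in rest k by rewrite -tx.
have cX : #|rest k :\ x| = (m - k.+1)%N by rewrite -tx card_rest.
have [||f_val prop] := round_proportional b0 xX winner _ _ fair.
- by rewrite cX; lia.
- by rewrite cX.
rewrite (mass_step bE) f_val cX; split.
  rewrite mulrBl massb (_ : m - k.+1 = (m - k.+2).+1)%N; last by lia.
  by rewrite !natrM -!natr1; ring.
have step : mass (b k) * (group_budget k - group_budget k.+1) <=
    2 * C * (utility k.+1 - utility k).
  rewrite (group_budget_step bE) -tx utility_step addrC addKr !mulr_sumr tx.
  apply: ler_sum => s _; have /andP[sh0 _] := share_bounds s.
  rewrite mulrCA; apply: le_trans (ler_wpM2l sh0 (prop s)) _.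
  have u0 : 0 <= (u_in s x (rest k))%:R :> R by [].
  by have := ler_wpM2r u0 (share_b s (ltnW km')); lra.
have mono : group_budget k.+1 <= group_budget k.
  rewrite -subr_ge0 (group_budget_step bE) sumr_ge0 // => s _.
  have /andP[sh0 _] := share_bounds s; rewrite mulr_ge0 //.
  by case: fair => -[flow_f _] _; case/andP: (flow_fs_bounds flow_f s).
(* The difference of squares is the budget drop times the sum of the two group budgets; that sum is
   at most [2 * mass (b k)], and [step] applies. *)
have := group_budget_le_mass (ltnW km').
have := group_budget_ge0 km'.
by nra.
Qed.

Let utility_mono k l : (k <= l)%N -> utility k <= utility l.
Proof.
move=> kl; rewrite /utility [leLHS]big_mkcond [leRHS]big_mkcond /=.
apply: ler_sum => x _; have nn : 0 <= \sum_s S s * (u_in s x (rest (t x)))%:R.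
  by apply: sumr_ge0 => s _; rewrite mulr_ge0 //; case: (subprofile_S s) => /andP[].
case: ifP => [tk | _]; last by case: ifP.
by rewrite (leq_trans tk kl).
Qed.

Let linear_phase k l : (k <= l <= m)%N ->
  group_budget k - group_budget l <= C * (utility l - utility k).
Proof.
case/andP; elim: l => [|l IH]; first by rewrite leqn0 => /eqP-> _; rewrite !subrr mulr0.
rewrite leq_eqVlt => /orP[/eqP-> _|]; first by rewrite !subrr mulr0.
by move=> /IH{}IH lm; have := IH (ltnW lm); have := step_linear lm; lra.
Qed.

(** The last quadratic step starts with four candidates left, so the invariant still holds when
    three are left, where it gives total budget 3. *)
Let quadratic_phase k : (k + 3 <= m)%N ->
  mass (b k) * 2 = ((m - k.+1) * (m - k.+1).+1)%:R /\
  group_budget 0 ^+ 2 - group_budget k ^+ 2 <= 4 * C * utility k.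
Proof.
elim: k => [m3 | k IH km].
  split; last by rewrite subrr mulr_ge0 ?mulr_ge0 // /utility big_pred0.
  rewrite mass_init /C -natrM -[2%N]/(1.+1) mulnC -mul_bin_diag bin1.
  by rewrite mulnC subn1 prednK //; lia.
have [|massb IHu] := IH; first by lia.
have [|-> step] := step_quadratic _ massb; first by lia.
by split=> //; lra.
Qed.

Let halving_step k : (k.+1 < m)%N -> mass (b k) <= 2 * (m - k.+1)%:R ->
  mass (b k.+1) <= mass (b k) / 2.
Proof.
move=> km massb; have km' := ltnW km.
have [x tx [winner [f [[max_f _] bE]]]] := exists_round km'.
have b0 s : 0 <= b k s by rewrite b_ge0 // ltnW.
have xX : x \in rest k by rewrite -tx.
have cX : #|rest k :\ x| = (m - k.+1)%N by rewrite -tx card_rest.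
have := round_halves b0 xX winner _ _ max_f; rewrite cX subn_gt0 (mass_step bE).
by move=> /(_ km massb); lra.
Qed.

(** With three and then two candidates left, the budget drops from 3 to at most 3/2 and then to at
    most 3/4. *)
Let final_mass : (1 < m)%N -> mass (b m.-1) <= 3 / 4 /\ mass (b (m - 3)) <= 3.
Proof.
move=> m2; have [m3 | m3] := leqP 3 m; last first.
  have m_eq : m = 2 by lia.
  have mass1 : mass (b 0%N) = 1 by rewrite mass_init /C m_eq.
  have -> : m.-1 = 1%N by rewrite m_eq.
  have -> : (m - 3 = 0)%N by rewrite m_eq.
  have := halving_step (k := 0) m2; rewrite mass1 (_ : m - 1 = 1)%N; last by rewrite m_eq.
  by move=> H; have := H ltac:(lra); lra.
have [|mass3 _] := @quadratic_phase (m - 3); first by lia.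
have {}mass3 : mass (b (m - 3)%N) = 3.
  move: mass3; rewrite (_ : m - (m - 3).+1 = 2)%N; last by lia.
  by rewrite natrM; lra.
rewrite mass3; split=> //.
have /= := @halving_step (m - 3); rewrite mass3.
rewrite (_ : m - (m - 3).+1 = 2)%N; last by lia.
move=> H1; have {}H1 := H1 ltac:(lia) ltac:(lra).
have := @halving_step (m - 3).+1; rewrite (_ : m - (m - 3).+2 = 1)%N; last by lia.
rewrite (_ : (m - 3).+2 = m.-1)%N; last by lia.
by move=> H2; have := H2 ltac:(lia) ltac:(lra); lra.
Qed.

Lemma group_utility : 0 < mass S ->
  mass S * (C * mass S / 4 - 3 / 16) <= utility m.
Proof.
have utility0 : utility 0 = 0 by rewrite /utility big_pred0.
move=> Q0; have U0 : 0 <= utility m by rewrite -utility0 utility_mono.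
(* With at most one candidate [C] is 0 and the bound is negative. *)
have [m1 | m2] := leqP m 1.
  by apply: le_trans U0; rewrite /C bin_small // mul0r mul0r sub0r pmulr_rle0 //; lra.
have C1 : 1 <= C by rewrite ler1n bin_gt0.
have [end_le mid_le] := final_mass m2.
have [km lm kl] : [/\ m - 3 <= m, m.-1 <= m & m - 3 <= m.-1]%N.
  by clear; split; lia.
(* For [m = 2] the quadratic phase is empty and both sides are 0. *)
have quad : group_budget 0 ^+ 2 - group_budget (m - 3) ^+ 2 <= 4 * C * utility (m - 3).
  have [m3 | m3] := leqP 3 m; first by apply: (quadratic_phase _).2; rewrite subnK.
  have -> : (m - 3 = 0)%N by apply/eqP; rewrite subn_eq0 ltnW.
  by rewrite subrr utility0 mulr0.
have lin : group_budget (m - 3) - group_budget m.-1 <=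
    C * (utility m.-1 - utility (m - 3)).
  by apply: linear_phase; rewrite kl lm.
have le_init : group_budget (m - 3) <= group_budget 0.
  apply: ler_sum => s _; apply: ler_wpM2l; first by case/andP: (share_bounds s).
  exact: b_antimono.
have ge0 := group_budget_ge0 km.
have le3 := le_trans (group_budget_le_mass km) mid_le.
have le34 := le_trans (group_budget_le_mass lm) end_le.
rewrite group_budget_init in quad le_init.
apply: (two_phase_bound C1 quad lin) => //; exact: utility_mono.
Qed.

End Outcome.

Theorem mainTheorem12 (R : realType) (m : nat)
  (P : {ffun {perm 'I_m} -> R}) (t : {perm 'I_m}) :
  is_profile P -> FAB_outcome P t ->
  forall S : {ffun {perm 'I_m} -> R}, is_subprofile P S -> 0 < mass S ->
  (mass S)^-1 * (\sum_(s : {perm 'I_m}) S s * (u_agree s t)%:R)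
    >= ('C(m, 2))%:R * mass S / 4 - 3 / 16.
Proof.
move=> profile_P [b [b_init round]] S subprofile_S S0.
rewrite ler_pdivlMl //.
apply: le_trans (group_utility profile_P subprofile_S b_init round S0) _.
(* After [m] rounds every candidate is placed, so [utility m] sums over all of them. *)
rewrite (eq_bigl xpredT) => [|x]; last exact: ltn_ord.
rewrite exchange_big /= le_eqVlt; apply/orP; left; apply/eqP.
by apply: eq_bigr => s _; rewrite u_agreeE natr_sum mulr_sumr.
Qed.
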